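(* Let $n\geq 2$, $c\geq 1$, and let $L_{n,c}$ be the free metabelian nilpotent Lie algebra of nilpotency class $c$ generated by $x_1,\ldots,x_n$ over a field $K$ of characteristic zero. For $u\in L_{n,c}$ let \[\varepsilon_u=\exp(\mathrm{ad}\,u)=1+\mathrm{ad}\,u+\tfrac{1}{2}\mathrm{ad}^2u+\cdots+\tfrac{1}{(c-1)!}\mathrm{ad}^{c-1}u,\] where $(\mathrm{ad}\,u)(v)=[v,u]$. Let $\mathrm{Inn}(L_{n,c}^{S_n})$ be the set of inner automorphisms $\varepsilon_u$ ($u\in L_{n,c}$) of $L_{n,c}$ that map $L_{n,c}^{S_n}$ into itself. Then \[\mathrm{Inn}(L_{n,c}^{S_n})=\{\varepsilon_u\mid u\in L_{n,c}^{S_n}\setminus\gamma^c(L_{n,c})^{S_n}\}\cup\{1\}.\]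
   Context: $L_{n,c}=L_n/(L_n''+\gamma^{c+1}(L_n))$, where $L_n$ is the free Lie algebra on $x_1,\ldots,x_n$, $\gamma^1=L_n$, $\gamma^k=[\gamma^{k-1},L_n]$, $L_n''=[L_n',L_n']$; $\gamma^c(L_{n,c})$ is the image of $\gamma^c(L_n)$ in $L_{n,c}$. The symmetric group $S_n$ acts on $L_{n,c}$ by $\pi\, p(x_1,\ldots,x_n)=p(x_{\pi(1)},\ldots,x_{\pi(n)})$; $L_{n,c}^{S_n}$ is the algebra of symmetric elements and $\gamma^c(L_{n,c})^{S_n}$ the set of symmetric elements of $\gamma^c(L_{n,c})$. Each $\varepsilon_u$ is an automorphism of $L_{n,c}$, and $\varepsilon_u=1$ when $u\in\gamma^c(L_{n,c})$. *)

(* Defs.v *)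
From mathcomp Require Import all_boot all_order all_algebra all_fingroup.
Set Implicit Arguments. Unset Strict Implicit. Unset Printing Implicit Defensive.
Import GRing.Theory.
Local Open Scope ring_scope.

Record lieAlgebra (K : fieldType) := LieAlgebra {
  lie_sort :> lmodType K;
  lie_br : lie_sort -> lie_sort -> lie_sort;
  lie_brDl : forall (a : K) (x y z : lie_sort),
      lie_br (a *: x + y) z = a *: lie_br x z + lie_br y z;
  lie_brDr : forall (a : K) (x y z : lie_sort),
      lie_br z (a *: x + y) = a *: lie_br z x + lie_br z y;
  lie_brxx : forall x : lie_sort, lie_br x x = 0;
  lie_jacobi : forall x y z : lie_sort,
      lie_br x (lie_br y z) + lie_br y (lie_br z x) + lie_br z (lie_br x y) = 0
}.
Arguments lie_br {K L} : rename.

Section LieDefs.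
Variable K : fieldType.

Inductive span (V : lmodType K) (S : V -> Prop) : V -> Prop :=
| span0 : span S 0
| spanS x : S x -> span S x
| spanD (a : K) x y : span S x -> span S y -> span S (a *: x + y).

Definition lie_hom (L M : lieAlgebra K) (f : L -> M) : Prop :=
  (forall (a : K) (x y : L), f (a *: x + y) = a *: f x + f y) /\
  (forall x y : L, f (lie_br x y) = lie_br (f x) (f y)).

Inductive lie_gen (L : lieAlgebra K) (I : Type) (y : I -> L) : L -> Prop :=
| lie_gen0 : lie_gen y 0
| lie_genG i : lie_gen y (y i)
| lie_genD (a : K) u v : lie_gen y u -> lie_gen y v -> lie_gen y (a *: u + v)
| lie_genB u v : lie_gen y u -> lie_gen y v -> lie_gen y (lie_br u v).

Definition free_lie (n : nat) (F : lieAlgebra K) (y : 'I_n -> F) : Prop :=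
  (forall u : F, lie_gen y u) /\
  (forall (M : lieAlgebra K) (m : 'I_n -> M),
      exists g : F -> M, lie_hom g /\ forall i, g (y i) = m i).

Fixpoint gamma (L : lieAlgebra K) (k : nat) : L -> Prop :=
  match k with
  | 0 => fun _ => True
  | 1 => fun _ => True
  | S k' => span (fun w : L => exists u v, gamma k' u /\ w = lie_br u v)
  end.

Definition der1 (L : lieAlgebra K) : L -> Prop :=
  span (fun w : L => exists u v, w = lie_br u v).
Definition der2 (L : lieAlgebra K) : L -> Prop :=
  span (fun w : L => exists u v, der1 u /\ der1 v /\ w = lie_br u v).

(* (L, x) is L_{n,c} = L_n / (L_n'' + gamma^{c+1}(L_n)) presented through the
   canonical projection pi from the free Lie algebra (F, y) = L_n, with
   x_i = pi (y_i). *)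
Definition is_Lnc (n c : nat) (F : lieAlgebra K) (y : 'I_n -> F)
    (L : lieAlgebra K) (x : 'I_n -> L) (pi : F -> L) : Prop :=
  [/\ free_lie y, lie_hom pi, (forall v : L, exists w, pi w = v),
      (forall w : F, pi w = 0 <->
          exists a b, der2 a /\ gamma (c.+1) b /\ w = a + b)
    & forall i, x i = pi (y i)].

Definition gammaLnc (F L : lieAlgebra K) (pi : F -> L) (c : nat) (u : L) :=
  exists w, gamma c w /\ pi w = u.

Definition sym_elt (n : nat) (L : lieAlgebra K) (x : 'I_n -> L) (u : L) :=
  forall (s : 'S_n) (f : L -> L),
    lie_hom f -> (forall i, f (x i) = x (s i)) -> f u = u.

Definition eps (L : lieAlgebra K) (c : nat) (u : L) (v : L) : L :=
  \sum_(k < c) (k`!%:R)^-1 *: iter k (fun w => lie_br w u) v.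

End LieDefs.

(* Main.v *)
Require Import Defs.
From HB Require Import structures.
From Stdlib Require Import Classical.
From mathcomp Require Import all_boot all_order all_algebra all_fingroup.
From mathcomp Require Import ssrcomplements mpoly ring.

(* Write s = x_1 + ... + x_n, which is symmetric. If eps_u preserves symmetric
   elements and f is the automorphism induced by a permutation, then
   eps_u(s) = f(eps_u(s)) = eps_{f u}(s). We show that this forces f u - u to lie in
   gamma^c; averaging u over S_n then changes it by an element of gamma^c only, which
   is central, so eps_u is unchanged and u has become symmetric.

   To solve eps_u(s) = eps_w(s), use the Magnus embedding theta of the free metabelian
   Lie algebra into S (+) S^n, S = K[X_1, ..., X_n], with x_i |-> (X_i, e_i) and bracket
   [(p, f), (q, g)] = (0, q f - p g). If theta(u) = (p, f), then
   theta(eps_u(s)) = (_, 1 + ((exp p - 1) / p) (p 1 - (X_1 + ... + X_n) f)), and modulo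
   terms of degree >= c this determines p (up to a multiple of X_1 + ... + X_n, excluded
   by comparing coefficient sums) and then f modulo degree >= c - 1. To return to L,
   note that the image of L' consists of Koszul boundaries, for which the exterior
   derivative, divided by the degree, is a contracting homotopy in characteristic zero. *)

Set Implicit Arguments. Unset Strict Implicit. Unset Printing Implicit Defensive.
Import GRing.Theory.
Local Open Scope ring_scope.

(* The [span] of [vector.v] would otherwise shadow that of [Defs]. *)
Local Notation span := Defs.span.

(** * Linear spans *)

Section Span.
Variables (K : fieldType) (V W : lmodType K).
Implicit Types (S : V -> Prop) (T : W -> Prop).

Lemma spanZ S a v : span S v -> span S (a *: v).
Proof. by move=> Sv; rewrite -[_ *: _]addr0; apply: spanD => //; apply: span0. Qed.

Lemma span_add S u v : span S u -> span S v -> span S (u + v).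
Proof. by move=> Su Sv; rewrite -[u]scale1r; apply: spanD. Qed.

Lemma span_sum S (I : Type) (r : seq I) (P : pred I) (F : I -> V) :
  (forall i, P i -> span S (F i)) -> span S (\sum_(i <- r | P i) F i).
Proof.
move=> SF; elim/big_rec: _ => [|i v Pi]; first exact: span0.
by apply: span_add; apply: SF.
Qed.

Lemma span_map S T (f : V -> W) :
    (forall a u v, f (a *: u + v) = a *: f u + f v) ->
    (forall v, S v -> span T (f v)) ->
  forall v, span S v -> span T (f v).
Proof.
move=> fL fS v; elim=> [|//|a u w _ Tu _ Tw]; last by rewrite fL; apply: spanD.
by have := fL (-1) 0 0; rewrite scaler0 addr0 scaleN1r addNr => ->; apply: span0.
Qed.

End Span.

(** * Brackets, the lower central series and exponentials of [ad] *)

Section LieTheory.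
Variables (K : fieldType) (L : lieAlgebra K).
Implicit Types u v w : L.

HB.instance Definition _ w :=
  GRing.isLinear.Build K L L *:%R (lie_br w) (fun a u v => lie_brDr a u v w).

Definition ad w v : L := lie_br v w.

HB.instance Definition _ w :=
  GRing.isLinear.Build K L L *:%R (ad w) (fun a u v => lie_brDl a u v w).

Lemma adE w v : lie_br v w = ad w v. Proof. by []. Qed.

Lemma lie_brC u v : lie_br u v = - lie_br v u.
Proof.
apply/eqP; rewrite -addr_eq0; apply/eqP.
have := lie_brxx (u + v); rewrite linearD /= !adE !linearD /= /ad !lie_brxx.
by rewrite add0r addr0 addrC.
Qed.

Lemma lie_br_addl u v w : lie_br (u + v) w = lie_br u w + lie_br v w.
Proof. exact: (linearD (ad w)). Qed.

Lemma lie_br_exch u v w :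
  lie_br (lie_br u v) w = lie_br (lie_br u w) v + lie_br u (lie_br v w).
Proof.
have := lie_jacobi u v w; rewrite [lie_br w (lie_br u v)]lie_brC => /eqP.
rewrite subr_eq0 => /eqP <-.
rewrite [lie_br v (lie_br w u)]lie_brC [lie_br w u]lie_brC !adE linearN /= /ad.
by rewrite opprK addrC.
Qed.

Lemma gammaSS k : @gamma K L k.+2 =
  span (fun w => exists u v, gamma k.+1 u /\ w = lie_br u v).
Proof. by []. Qed.

(** Absorbs the degenerate indices [0] and [1], so that linear closure needs no case split. *)
Lemma gammaP k : exists S, forall u : L, gamma k u <-> span S u.
Proof.
case: k => [|[|k]]; last by eexists => u; rewrite gammaSS; split; exact: id.
- by exists (fun=> True) => u; split=> // _; apply: spanS.
- by exists (fun=> True) => u; split=> // _; apply: spanS.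
Qed.

Lemma gammaZ k a u : gamma k u -> gamma k (a *: u).
Proof. by have [S gS] := gammaP k; move/gS => ?; apply/gS/spanZ. Qed.

Lemma gamma0 k : gamma k (0 : L).
Proof. by have [S gS] := gammaP k; apply/gS/span0. Qed.

Lemma gamma_sum k (I : Type) (r : seq I) (P : pred I) (F : I -> L) :
  (forall i, P i -> gamma k (F i)) -> gamma k (\sum_(i <- r | P i) F i).
Proof. by have [S gS] := gammaP k => h; apply/gS/span_sum => i /h/gS. Qed.

Lemma gamma_br k u v : gamma k.+1 u -> gamma k.+2 (lie_br u v).
Proof. by move=> gu; rewrite gammaSS; apply: spanS; exists u, v. Qed.

Lemma gammaW k u : gamma k.+1 u -> gamma k u.
Proof.
elim: k u => [//|[|k] IH] u // gu.
rewrite gammaSS in gu; rewrite gammaSS.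
apply: (span_map (f := id)) gu => // _ [v [w [gv ->]]].
by apply: spanS; exists v, w; split=> //; apply: IH.
Qed.

Lemma gamma_le j k u : (j <= k)%N -> gamma k u -> gamma j u.
Proof.
move=> /subnK <-; elim: (k - j)%N => [//|d IH]; rewrite addSn => /gammaW.
exact: IH.
Qed.

Lemma der1_br u v : der1 (lie_br u v).
Proof. by apply: spanS; exists u, v. Qed.

Lemma eps1 u v : eps 1 u v = v.
Proof. by rewrite /eps big_ord1 /= invr1 scale1r. Qed.

Lemma eps0 c v : (0 < c)%N -> eps c 0 v = v.
Proof.
case: c => // c _; rewrite /eps big_ord_recl /= invr1 scale1r big1 ?addr0 // => i _.
by rewrite linear0 scaler0.
Qed.

Lemma eps_eq_ad c u v w :
  (forall z, lie_br z u = lie_br z v) -> eps c u w = eps c v w.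
Proof. by move=> uv; apply: eq_bigr => k _; congr (_ *: _); apply: eq_iter. Qed.

End LieTheory.

(** * Images and lifts of the lower central and derived series *)

Section LieHom.
Variables (K : fieldType) (L M : lieAlgebra K) (f : L -> M).
Hypothesis fH : lie_hom f.

Lemma hom_br u v : f (lie_br u v) = lie_br (f u) (f v).
Proof. by case: fH. Qed.

Lemma hom0 : f 0 = 0.
Proof.
by have [fL _] := fH; have := fL (-1) 0 0; rewrite scaler0 addr0 scaleN1r addNr.
Qed.

Lemma homD u v : f (u + v) = f u + f v.
Proof. by have [fL _] := fH; rewrite -[u in LHS]scale1r fL scale1r. Qed.

Lemma homZ a u : f (a *: u) = a *: f u.
Proof. by have [fL _] := fH; rewrite -[_ *: u in LHS]addr0 fL hom0 addr0. Qed.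

Lemma homB u v : f (u - v) = f u - f v.
Proof. by rewrite homD -scaleN1r homZ scaleN1r. Qed.

Lemma hom_sum (I : Type) (r : seq I) (P : pred I) (F : I -> L) :
  f (\sum_(i <- r | P i) F i) = \sum_(i <- r | P i) f (F i).
Proof. exact: (big_morph f homD hom0). Qed.

Lemma hom_eps c u v : f (eps c u v) = eps c (f u) (f v).
Proof.
rewrite hom_sum; apply: eq_bigr => k _; rewrite homZ; congr (_ *: _).
by elim: (k : nat) => //= j <-; rewrite hom_br.
Qed.

Lemma gamma_hom k u : gamma k u -> gamma k (f u).
Proof.
elim: k u => [//|[//|k] IH] u; rewrite !gammaSS.
apply: span_map; first by case: fH.
by move=> _ [v [w [gv ->]]]; rewrite hom_br; apply/gamma_br/IH.
Qed.

Lemma der1_hom u : der1 u -> der1 (f u).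
Proof.
apply: span_map; first by case: fH.
by move=> _ [v [w ->]]; rewrite hom_br; apply: der1_br.
Qed.

Lemma der2_hom u : der2 u -> der2 (f u).
Proof.
apply: span_map; first by case: fH.
move=> _ [v [w [dv [dw ->]]]]; rewrite hom_br; apply: spanS.
by exists (f v), (f w); split; [|split=> //]; apply: der1_hom.
Qed.

Hypothesis f_surj : forall v, exists w, f w = v.

Lemma span_lift (S : M -> Prop) (T : L -> Prop) :
    (forall v, S v -> exists w, T w /\ f w = v) ->
  forall v, span S v -> exists w, span T w /\ f w = v.
Proof.
move=> ST v; elim=> [|u /ST[w [Tw <-]]|a u1 u2 _ [w1 [T1 <-]] _ [w2 [T2 <-]]].
- by exists 0; split; [apply: span0 | rewrite hom0].
- by exists w; split=> //; apply: spanS.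
- by exists (a *: w1 + w2); rewrite homD homZ; split=> //; apply: spanD.
Qed.

Lemma gamma_lift k v : gamma k v -> exists w, gamma k w /\ f w = v.
Proof.
elim: k v => [|[|k] IH] v.
- by move=> _; have [w <-] := f_surj v; exists w.
- by move=> _; have [w <-] := f_surj v; exists w.
rewrite !gammaSS; apply: span_lift => _ [u [w [/IH[u' [gu' <-]] ->]]].
have [w' <-] := f_surj w; exists (lie_br u' w'); rewrite hom_br; split=> //.
by exists u', w'.
Qed.

Lemma der1_lift v : der1 v -> exists w, der1 w /\ f w = v.
Proof.
apply: span_lift => _ [u [w ->]].
have [u' <-] := f_surj u; have [w' <-] := f_surj w.
by exists (lie_br u' w'); rewrite hom_br; split=> //; exists u', w'.
Qed.

End LieHom.

Section Generation.
Variables (K : fieldType) (L M : lieAlgebra K) (I : Type) (y : I -> L).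
Hypothesis y_gen : forall u, lie_gen y u.

(** The uniqueness half of the universal property: [free_lie] states existence, and generation gives
    uniqueness. *)
Lemma lie_hom_ext (f g : L -> M) : lie_hom f -> lie_hom g ->
  (forall i, f (y i) = g (y i)) -> f =1 g.
Proof.
move=> fH gH fg u; elim: (y_gen u) => [|//|a v w _ IHv _ IHw|v w _ IHv _ IHw].
- by rewrite !hom0.
- by rewrite !homD // !homZ // IHv IHw.
- by rewrite !hom_br // IHv IHw.
Qed.

End Generation.

(** * Order of vanishing of a polynomial at the origin *)

Section Order.
Variables (K : fieldType) (n : nat).
Local Notation S := {mpoly K[n]}.
Implicit Types (p q : S) (d : nat) (m : 'X_{1..n}).

(** Membership in the [d]-th power of the ideal [(X_1, ..., X_n)]. *)
Definition mord d p := forall m, (mdeg m < d)%N -> p@_m = 0.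

Lemma mord0 d : mord d 0. Proof. by move=> m _; rewrite mcoeff0. Qed.

Lemma mord_le d e p : (e <= d)%N -> mord d p -> mord e p.
Proof. by move=> led pd m ltm; apply/pd/(leq_trans ltm). Qed.

Lemma mordD d p q : mord d p -> mord d q -> mord d (p + q).
Proof. by move=> pd qd m ltm; rewrite mcoeffD pd ?qd ?addr0. Qed.

Lemma mordN d p : mord d p -> mord d (- p).
Proof. by move=> pd m ltm; rewrite mcoeffN pd ?oppr0. Qed.

Lemma mordB d p q : mord d p -> mord d q -> mord d (p - q).
Proof. by move=> pd qd; apply/mordD/mordN. Qed.

Lemma mordZ d a p : mord d p -> mord d (a *: p).
Proof. by move=> pd m ltm; rewrite mcoeffZ pd ?mulr0. Qed.

Lemma mordMn d p k : mord d p -> mord d (p *+ k).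
Proof. by move=> pd m ltm; rewrite mcoeffMn pd ?mul0rn. Qed.

Lemma mord_sum d (I : Type) (r : seq I) (P : pred I) (F : I -> S) :
  (forall i, P i -> mord d (F i)) -> mord d (\sum_(i <- r | P i) F i).
Proof. by move=> Fd; apply: big_ind => //; [apply: mord0 | apply: mordD]. Qed.

Lemma mordM d e p q : mord d p -> mord e q -> mord (d + e) (p * q).
Proof.
move=> pd qe m ltm; rewrite mcoeffM big1 // => -[[m1 /= _] [m2 /= _]] /eqP mE.
have [ltd|led] := ltnP (mdeg m1) d; first by rewrite pd ?mul0r.
by rewrite [q@__]qe ?mulr0 // -(ltn_add2l d) (leq_ltn_trans _ ltm) // mE mdegD leq_add2r.
Qed.

Lemma mordMl d p q : mord d q -> mord d (p * q).
Proof. exact: (@mordM 0%N). Qed.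

Lemma mordX d m : (d <= mdeg m)%N -> mord d 'X_[m].
Proof.
move=> led k ltk; rewrite mcoeffX; case: eqP => // mk.
by rewrite -mk ltnNge led in ltk.
Qed.

(** Such a [p] is invertible as a power series. In [q = p * q - (p - 1) * q] the last product gains
    one order on [q]. *)
Lemma mord_cancel_unit d p q : mord 1 (p - 1) -> mord d (p * q) -> mord d q.
Proof.
move=> p1; elim: d => [//|d IH] pq.
have qd : mord d q by apply: IH; apply: mord_le pq.
have -> : q = p * q - (p - 1) * q by rewrite mulrBl mul1r opprB addrC subrK.
by apply: mordB => //; apply: (@mordM 1%N).
Qed.

Lemma mord_split d p : exists p1 p2, [/\ p = p1 + p2, (msize p1 <= d)%N & mord d p2].
Proof.
pose P m := (mdeg m < d)%N.
exists (\sum_(m <- msupp p | P m) p@_m *: 'X_[m]),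
       (\sum_(m <- msupp p | ~~ P m) p@_m *: 'X_[m]); split.
- by rewrite {1}[p]mpolyE (bigID P).
- apply: (leq_trans (msize_sum _ _ _)); apply/bigmax_leqP_seq => m _ Pm.
  by apply: (leq_trans (msizeZ_le _ _)); rewrite msizeX.
- by apply: mord_sum => m; rewrite /P -leqNgt => led; apply/mordZ/mordX.
Qed.

(** If [q1] is the part of [q] of degree below [d], then [p * q1] has degree at most [d] but order
    at least [d.+1], so it is zero, and polynomials form a domain. *)
Lemma mord_cancel_linear d p q :
  p != 0 -> (msize p <= 2)%N -> mord 1 p -> mord d.+1 (p * q) -> mord d q.
Proof.
move=> p0 p2 p1 pq; have [q1 [q2 [qE q1d q2d]]] := mord_split d q.
suff q10 : q1 = 0 by rewrite qE q10 add0r.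
have pq1 : mord d.+1 (p * q1).
  have -> : p * q1 = p * q - p * q2 by rewrite qE mulrDr addrK.
  by apply: mordB => //; apply: (@mordM 1%N).
apply/eqP; case: eqP => // /eqP q10; have : p * q1 == 0; last first.
  by rewrite mulf_eq0 (negbTE p0) (negbTE q10).
rewrite -msupp_eq0; case E: (msupp _) => [//|m r].
have : m \in msupp (p * q1) by rewrite E mem_head.
move=> mM; have := mM; rewrite mcoeff_msupp pq1 ?eqxx //.
rewrite (leq_trans (msize_mdeg_lt mM)) // msizeM //.
have : (0 < msize p)%N by rewrite lt0n msize_poly_eq0.
case: (msize p) p2 => // k; rewrite ltnS => k1 _ /=.
by apply: (leq_trans (leq_add k1 q1d)).
Qed.

End Order.

(** * Linear maps prescribed on monomials *)

Section LinearExtension.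
Variables (K : fieldType) (n : nat) (V : lmodType K) (h : 'X_{1..n} -> V).
Implicit Types p q : {mpoly K[n]}.

Definition mlin p : V := \sum_(m <- msupp p) p@_m *: h m.

Lemma mlinE p d : (msize p <= d)%N ->
  mlin p = \sum_(m : 'X_{1..n < d}) p@_m *: h m.
Proof.
move=> le_pd; rewrite /mlin (big_mksub 'X_{1..n < d}) ?msupp_uniq //=; last first.
  by move=> m /msize_mdeg_lt /leq_trans; apply.
by rewrite big_rmcond //= => m /memN_msupp_eq0 ->; rewrite scale0r.
Qed.

Lemma mlin_is_linear a p q : mlin (a *: p + q) = a *: mlin p + mlin q.
Proof.
pose d := maxn (msize p) (maxn (msize q) (msize (a *: p + q))).
rewrite !(@mlinE _ d) ?leq_max ?leqnn ?orbT // scaler_sumr -big_split /=.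
by apply: eq_bigr => m _; rewrite mcoeffD mcoeffZ scalerDl scalerA.
Qed.

HB.instance Definition _ :=
  GRing.isLinear.Build K {mpoly K[n]} V *:%R mlin mlin_is_linear.

Lemma mlinX m : mlin 'X_[m] = h m.
Proof. by rewrite /mlin msuppX big_seq1 mcoeffX eqxx scale1r. Qed.

End LinearExtension.

(** * The Magnus Lie algebra *)

Section Magnus.
Variables (K : fieldType) (n : nat).
Local Notation S := {mpoly K[n]}.

Definition magnus : lmodType K := (S * {ffun 'I_n -> S})%type.

Definition magnus_br (u v : magnus) : magnus :=
  (0, [ffun i => v.1 * u.2 i - u.1 * v.2 i]).

Lemma magnus_brDl a u v w :
  magnus_br (a *: u + v) w = a *: magnus_br u w + magnus_br v w.
Proof.
congr (_, _); first by rewrite /= scaler0 addr0.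
apply/ffunP => i; rewrite !ffunE /= mulrDl mulrDr -scalerAl -scalerAr.
by rewrite scalerBr opprD addrACA.
Qed.

Lemma magnus_brxx u : magnus_br u u = 0.
Proof. by congr (_, _); apply/ffunP => i; rewrite !ffunE subrr. Qed.

Lemma magnus_brC u v : magnus_br u v = - magnus_br v u.
Proof. by congr (_, _); [rewrite oppr0 | apply/ffunP => i; rewrite !ffunE opprB]. Qed.

Lemma magnus_brDr a u v w :
  magnus_br w (a *: u + v) = a *: magnus_br w u + magnus_br w v.
Proof.
by rewrite magnus_brC magnus_brDl opprD -scalerN -!magnus_brC.
Qed.

Lemma magnus_jacobi u v w :
  magnus_br u (magnus_br v w) + magnus_br v (magnus_br w u)
    + magnus_br w (magnus_br u v) = 0.
Proof.
congr (_, _); first by rewrite /= !addr0.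
by apply/ffunP => i; rewrite !ffunE /=; ring.
Qed.

Definition magnus_lie : lieAlgebra K :=
  LieAlgebra magnus_brDl magnus_brDr magnus_brxx magnus_jacobi.

Definition magnus_gen (i : 'I_n) : magnus_lie := ('X_i, [ffun j => (j == i)%:R]).

Definition magnus_lin (u : magnus_lie) : S := u.1.

(* On the image of the free Lie algebra: the abelianized [i]-th Fox derivative. *)
Definition magnus_fox (i : 'I_n) (u : magnus_lie) : S := u.2 i.

Lemma magnus_eqP (u v : magnus_lie) :
  magnus_lin u = magnus_lin v -> (forall i, magnus_fox i u = magnus_fox i v) -> u = v.
Proof. by case: u v => [u1 u2] [v1 v2] /= uv1 /ffunP uv2; congr (_, _). Qed.

Lemma magnus_lin_is_linear a u v :
  magnus_lin (a *: u + v) = a *: magnus_lin u + magnus_lin v.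
Proof. by []. Qed.

HB.instance Definition _ :=
  GRing.isLinear.Build K magnus_lie S *:%R magnus_lin magnus_lin_is_linear.

Lemma magnus_fox_is_linear i a u v :
  magnus_fox i (a *: u + v) = a *: magnus_fox i u + magnus_fox i v.
Proof. by rewrite /magnus_fox !ffunE. Qed.

HB.instance Definition _ i := GRing.isLinear.Build K magnus_lie S *:%R
  (magnus_fox i) (magnus_fox_is_linear i).

Lemma magnus_lin_gen i : magnus_lin (magnus_gen i) = 'X_i. Proof. by []. Qed.

Lemma magnus_fox_gen i j : magnus_fox j (magnus_gen i) = (j == i)%:R.
Proof. exact: ffunE. Qed.

Lemma magnus_lin_br u v : magnus_lin (lie_br u v) = 0. Proof. by []. Qed.

Lemma magnus_fox_br u v i : magnus_fox i (lie_br u v) =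
  magnus_lin v * magnus_fox i u - magnus_lin u * magnus_fox i v.
Proof. exact: ffunE. Qed.

End Magnus.

(** * Exponentials in the Magnus algebra and their injectivity *)

Section ExpQuotient.
Variables (K : fieldType) (n : nat).
Local Notation S := {mpoly K[n]}.
Implicit Types p q : S.

Definition linform (a : 'I_n -> K) : S := \sum_i a i *: 'X_i.

Lemma linformP k a b : linform (fun i => k * a i + b i) = k *: linform a + linform b.
Proof.
rewrite /linform scaler_sumr -big_split /=.
by apply: eq_bigr => i _; rewrite scalerDl scalerA.
Qed.

Lemma mcoeff_linform a j : (linform a)@_U_(j) = a j.
Proof.
rewrite /linform raddf_sum (bigD1 j) //= mcoeffZ mcoeffXU eqxx mulr1.
by rewrite big1 ?addr0 // => i /negbTE ij; rewrite mcoeffZ mcoeffXU ij mulr0.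
Qed.

Lemma mord_linform a : mord 1 (linform a).
Proof. by apply: mord_sum => i _; apply/mordZ/mordX; rewrite mdeg1. Qed.

Lemma msize_linform a : (msize (linform a) <= 2)%N.
Proof.
apply: (leq_trans (msize_sum _ _ _)); apply/bigmax_leqP_seq => i _ _.
by apply: (leq_trans (msizeZ_le _ _)); rewrite msizeX mdeg1.
Qed.

(* The truncation of (exp p - 1) / p. *)
Definition expq c p : S := \sum_(k < c) (k.+1`!%:R)^-1 *: p ^+ k.

Lemma mord_expq c p : mord 1 p -> mord 1 (expq c.+1 p - 1).
Proof.
move=> p1; rewrite /expq big_ord_recl /= expr0 invr1 scale1r addrAC subrr add0r.
apply: mord_sum => k _; apply: mordZ; rewrite exprS -[1%N]addn0.
exact: mordM.
Qed.

(** One bracket kills the linear component, after which each bracket with [u] multiplies the Fox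
    component by [magnus_lin u]. The first bracket thus adds no power, whence the shifted factorial
    in [expq]. *)
Lemma magnus_eps c (u v : magnus_lie K n) i :
  magnus_fox i (eps c.+1 u v) = magnus_fox i v + expq c (magnus_lin u) *
    (magnus_lin u * magnus_fox i v - magnus_lin v * magnus_fox i u).
Proof.
set r := _ - _; have itE k : magnus_lin (iter k.+1 (lie_br^~ u) v) = 0 /\
    magnus_fox i (iter k.+1 (lie_br^~ u) v) = magnus_lin u ^+ k * r.
  elim: k => [|k [IH1 IH2]]; first by rewrite magnus_fox_br expr0 mul1r.
  by rewrite iterS magnus_lin_br magnus_fox_br IH1 IH2 mul0r subr0 exprS mulrA.
rewrite /eps (linear_sum (magnus_fox i)) big_ord_recl /= invr1 scale1r.
congr (_ + _); rewrite /expq mulr_suml; apply: eq_bigr => k _.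
by rewrite linearZ /= (itE k).2 scalerAl.
Qed.

(** In degree one, [linform a] and [linform b] can differ only by a multiple of [s], which equal
    coefficient sums exclude. Then, in the difference [E * (s * (g i - f i))], cancelling the unit
    [E] costs no order and cancelling [s] costs one. *)
Lemma expq_inj c (a b : 'I_n -> K) (f g : 'I_n -> S) (s := linform (fun=> 1)) :
    [pchar K] =i pred0 -> \sum_i a i = \sum_i b i ->
    (forall i, mord 1 (f i - (a i)%:MP)) ->
    (forall i, mord 1 (g i - (b i)%:MP)) ->
    (forall i, mord c.+2 (expq c.+1 (linform a) * (linform a - s * f i)
                        - expq c.+1 (linform b) * (linform b - s * g i))) ->
  a =1 b /\ forall i, mord c.+1 (f i - g i).
Proof.
move=> charK ab fa gb fg.
have s1 : mord 1 s by apply: mord_linform.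
(* The part of degree one: [expq] contributes its constant term [1] and [h] its constant term
   [e i]. *)
have low e h i : mord 1 (h - (e i)%:MP) ->
    mord 2 (expq c.+1 (linform e) * (linform e - s * h) - (linform e - e i *: s)).
  move=> he; pose p := linform e.
  have -> : expq c.+1 p * (p - s * h) - (p - e i *: s) =
      (expq c.+1 p - 1) * (p - s * h) - s * (h - (e i)%:MP).
    by rewrite -mul_mpolyC; ring.
  apply: mordB; last exact: (@mordM _ _ 1 1).
  apply: (@mordM _ _ 1 1); first exact/mord_expq/mord_linform.
  by apply: mordB; [apply: mord_linform | rewrite mulrC; apply: mordMl].
have coef i j : a j - a i = b j - b i.
  have /(_ U_(j)%MM) : mord 2 ((linform a - a i *: s) - (linform b - b i *: s)).
    set A := linform a - _; set B := linform b - _.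
    set P := expq c.+1 (linform a) * (linform a - s * f i).
    set Q := expq c.+1 (linform b) * (linform b - s * g i).
    have -> : A - B = (P - Q) - (P - A) + (Q - B) by ring.
    apply: mordD; last exact: low.
    by apply: mordB; [apply: mord_le (fg i) | apply: low].
  rewrite mdeg1 => /(_ isT); rewrite !mcoeffB !mcoeffZ !mcoeff_linform !mulr1.
  by move/eqP; rewrite subr_eq0 => /eqP.
have eq_ab : a =1 b.
  move=> i; have : \sum_j (a j - a i) = \sum_j (b j - b i).
    by apply: eq_bigr => j _.
  (* What remains is [n * a i = n * b i], and [n] is nonzero because the index [i] exists. *)
  rewrite !sumrB ab => /addrI /oppr_inj; rewrite !sumr_const card_ord.
  move=> /eqP; rewrite -subr_eq0 -mulrnBl -mulr_natr mulf_eq0 subr_eq0.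
  case/orP => [/eqP //|]; rewrite ((pcharf0P K).1 charK).
  by move=> n0; have := ltn_ord i; rewrite [X in (_ < X)%N](eqP n0).
split=> // i.
have lin_ab : linform b = linform a by apply: eq_bigr => j _; rewrite eq_ab.
have := fg i; rewrite lin_ab.
set p := linform a; set E := expq _ _.
have -> : E * (p - s * f i) - E * (p - s * g i) = E * (s * (g i - f i)) by ring.
move/mord_cancel_unit => /(_ (mord_expq _ (mord_linform _))).
move/mord_cancel_linear => h; rewrite -opprB; apply/mordN/h => //.
  by apply/eqP => /(congr1 (mcoeff U_(i))) /eqP; rewrite mcoeff_linform mcoeff0 oner_eq0.
exact: msize_linform.
Qed.

End ExpQuotient.

(** The linear component of every [theta w] has no constant term, so each bracket raises the order
    by one. Fox components lag one behind because those of the generators are constants. *)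
Lemma magnus_gamma_mord (K : fieldType) (n k : nat) (F : lieAlgebra K)
    (y : 'I_n -> F) (theta : F -> magnus_lie K n) (u : F) :
    (forall w, lie_gen y w) -> lie_hom theta ->
    (forall i, theta (y i) = magnus_gen K i) ->
    gamma k.+1 u ->
  mord k.+1 (magnus_lin (theta u)) /\ forall i, mord k (magnus_fox i (theta u)).
Proof.
move=> y_gen thH thy.
have th1 w : mord 1 (magnus_lin (theta w)).
  elim: (y_gen w) => [|i|a v v' _ IH _ IH'|v v' _ _ _ _].
  - by rewrite (hom0 thH) linear0; apply: mord0.
  - by rewrite thy magnus_lin_gen; apply: mordX; rewrite mdeg1.
  - by rewrite (homD thH) (homZ thH) linearP; apply/mordD/IH'/mordZ.
  - by rewrite (hom_br thH) magnus_lin_br; apply: mord0.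
elim: k u => [u _|k IH u]; first by split.
rewrite gammaSS; elim=> [|{}u [v [w [/IH[v1 v2] ->]]]|a v w _ [v1 v2] _ [w1 w2]].
- rewrite (hom0 thH); split=> [|i]; first by rewrite linear0; apply: mord0.
  by rewrite linear0; apply: mord0.
- rewrite (hom_br thH); split=> [|i]; first by rewrite magnus_lin_br; apply: mord0.
  rewrite magnus_fox_br; apply: mordB; first exact: (@mordM _ _ 1).
  by rewrite mulrC; apply: mordMl.
- rewrite (homD thH) (homZ thH); split=> [|i].
    by rewrite linearP; apply/mordD/w1/mordZ.
  by rewrite magnus_fox_is_linear; apply/mordD/w2/mordZ.
Qed.

(** The derived algebra lies in the summand of Fox components, an abelian ideal. *)
Lemma magnus_der2 (K : fieldType) (n : nat) (u : magnus_lie K n) :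
  der2 u -> u = 0.
Proof.
have d1 (v : magnus_lie K n) : der1 v -> magnus_lin v = 0.
  elim=> [|w [w1 [w2 ->]]|a w1 w2 _ h1 _ h2] //.
  by rewrite linearP /= h1 h2 scaler0 addr0.
elim=> [//|_ [v [w [/d1 v0 [/d1 w0 ->]]]]|a v w _ -> _ ->]; last by rewrite scaler0 addr0.
apply: magnus_eqP => // i.
by rewrite magnus_fox_br v0 w0 !mul0r subrr linear0.
Qed.

(** * The derived algebra as a polynomial module, and the Koszul homotopy *)

Section Koszul.
Variables (K : fieldType) (n : nat) (L : lieAlgebra K) (x : 'I_n -> L).
Hypothesis L_metabelian : forall u v : L, der1 u -> der1 v -> lie_br u v = 0.
Local Notation S := {mpoly K[n]}.
Implicit Types (u v w z : L) (m : 'X_{1..n}) (r : seq 'I_n).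

Definition ad_seq r m v := foldr (fun i => iter (m i) (ad (x i))) v r.

(* The operators [ad x_i] only commute on [L']; elsewhere the order of [enum 'I_n]
   matters. *)
Definition ad_mon m v := ad_seq (enum 'I_n) m v.

Lemma der1_ad z v : der1 (ad z v).
Proof. exact: (der1_br v z). Qed.

Lemma der1_iter_ad k z v : der1 v -> der1 (iter k (ad z) v).
Proof. by case: k => // k _; apply: der1_ad. Qed.

Lemma der1_ad_seq r m v : der1 v -> der1 (ad_seq r m v).
Proof. by move=> dv; elim: r => //= i r; apply: der1_iter_ad. Qed.

(** The Jacobi defect [[v, [w, z]]] lies in [L''], which is zero. This lets [X_i] act on [L'] as
    [ad (x i)]. *)
Lemma ad_comm z w v : der1 v -> ad z (ad w v) = ad w (ad z v).
Proof.
move=> dv; rewrite /ad lie_br_exch [lie_br v (lie_br w z)]L_metabelian ?addr0 //.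
exact: der1_br.
Qed.

Lemma iter_ad_comm k z w v :
  der1 v -> iter k (ad w) (ad z v) = ad z (iter k (ad w) v).
Proof.
move=> dv; elim: k => //= k ->.
by rewrite ad_comm //; apply: der1_iter_ad.
Qed.

Lemma ad_seq_ad r m z v : der1 v -> ad_seq r m (ad z v) = ad z (ad_seq r m v).
Proof.
move=> dv; elim: r => //= i r ->.
by rewrite iter_ad_comm //; apply: der1_ad_seq.
Qed.

Lemma ad_seqDU r m i v : der1 v ->
  ad_seq r (m + U_(i))%MM v = iter (count_mem i r) (ad (x i)) (ad_seq r m v).
Proof.
move=> dv; elim: r => //= j r ->; rewrite mnmDE mnm1E eq_sym.
have dm := der1_ad_seq r m dv.
case: eqVneq => [->|_]; first by rewrite -!iterD -addnA [in RHS]addnC.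
rewrite addn0 add0n; elim: (count_mem i r) => //= k <-.
by rewrite iter_ad_comm //; apply: der1_iter_ad.
Qed.

Lemma ad_monDU m i v : der1 v -> ad_mon (m + U_(i))%MM v = ad (x i) (ad_mon m v).
Proof.
move=> dv; rewrite /ad_mon ad_seqDU //.
by rewrite (count_uniq_mem _ (enum_uniq 'I_n)) mem_enum.
Qed.

Lemma ad_mon_ad m z v : der1 v -> ad_mon m (ad z v) = ad z (ad_mon m v).
Proof. exact: ad_seq_ad. Qed.

Lemma ad_mon0 v : ad_mon 0%MM v = v.
Proof. by rewrite /ad_mon; elim: (enum _) => //= i r ->; rewrite mnm0E. Qed.

Lemma ad_mon_is_linear m a u v :
  ad_mon m (a *: u + v) = a *: ad_mon m u + ad_mon m v.
Proof.
rewrite /ad_mon; elim: (enum _) => //= i r ->.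
by elim: (m i) => //= k ->; rewrite linearP.
Qed.

HB.instance Definition _ m :=
  GRing.isLinear.Build K L L *:%R (ad_mon m) (ad_mon_is_linear m).

Lemma der1_ad_mon m v : der1 v -> der1 (ad_mon m v).
Proof. exact: der1_ad_seq. Qed.

Lemma gamma_iter_ad j k z v : gamma k.+1 v -> gamma (j + k).+1 (iter j (ad z) v).
Proof. by move=> gv; elim: j => // j; apply: gamma_br. Qed.

Lemma gamma_ad_mon m k v : gamma k.+1 v -> gamma (mdeg m + k).+1 (ad_mon m v).
Proof.
move=> gv; rewrite mdegE -big_enum /ad_mon.
elim: (enum _) => [|i r IH]; first by rewrite big_nil.
by rewrite big_cons -addnA; apply: gamma_iter_ad.
Qed.

(* The image of [[x_a, x_b] X^m] in the Magnus module: the Koszul boundary of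
   [X^m (e_a /\ e_b)]. *)
Definition koszul a b m : {ffun 'I_n -> S} :=
  [ffun i => 'X_[m + U_(b)] *+ (i == a) - 'X_[m + U_(a)] *+ (i == b)].

Definition homotopy_mon i m : L :=
  (mdeg m).+1%:R^-1 *: \sum_j (m j)%:R *: ad_mon (m - U_(j))%MM (lie_br (x i) (x j)).

(* The exterior derivative of the 1-form [\sum_i f_i dX_i], weighted by degree and
   with [dX_j /\ dX_i] read as [[x_i, x_j]]: a contracting homotopy for [koszul]. *)
Definition homotopy (f : {ffun 'I_n -> S}) : L := \sum_i mlin (homotopy_mon i) (f i).

Lemma homotopy_is_linear a f g :
  homotopy (a *: f + g) = a *: homotopy f + homotopy g.
Proof.
rewrite /homotopy scaler_sumr -big_split /=.
by apply: eq_bigr => i _; rewrite !ffunE linearP.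
Qed.

HB.instance Definition _ :=
  GRing.isLinear.Build K {ffun 'I_n -> S} L *:%R homotopy homotopy_is_linear.

(** Leibniz rule: differentiating the factor [X_b] gives the first summand; the other terms keep it
    as a further bracket with [x b]. *)
Lemma homotopy_monDU i m b :
  homotopy_mon i (m + U_(b))%MM =
  (mdeg m).+2%:R^-1 *: (ad_mon m (lie_br (x i) (x b)) +
    \sum_j (m j)%:R *: ad_mon (m - U_(j))%MM (lie_br (lie_br (x i) (x j)) (x b))).
Proof.
rewrite /homotopy_mon mdegD mdeg1 addn1; congr (_ *: _).
have -> : ad_mon m (lie_br (x i) (x b)) =
    \sum_j (U_(b)%MM j)%:R *: ad_mon (m + U_(b) - U_(j))%MM (lie_br (x i) (x j)).
  rewrite (bigD1 b) //= mnm1E eqxx scale1r addmK big1 ?addr0 // => j /negbTE jb.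
  by rewrite mnm1E eq_sym jb scale0r.
rewrite -big_split /=; apply: eq_bigr => j _.
rewrite mnmDE natrD scalerDl addrC; congr (_ + _).
(* For [m j = 0] the subtraction [m - U_(j)] is truncated, but the coefficient vanishes. *)
case E: (m j) => [|k]; first by rewrite !scale0r.
congr (_ *: _).
have -> : (m + U_(b) - U_(j) = m - U_(j) + U_(b))%MM.
  apply/mnmP => l; rewrite !mnmE addnBAC //.
  by case: eqVneq => // <-; rewrite E.
have dij := der1_br (x i) (x j).
by rewrite ad_monDU // -ad_mon_ad.
Qed.

(** The factors [X_a] and [X_b] yield two copies of the result and the factors of [X^m] yield
    [mdeg m] more; the divisor [(mdeg m).+2] is the total. *)
Lemma homotopy_koszul (charK : [pchar K] =i pred0) a b m :
  homotopy (koszul a b m) = ad_mon m (lie_br (x a) (x b)).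
Proof.
have pick c (h : 'I_n -> L) : \sum_i h i *+ (i == c) = h c.
  rewrite (bigD1 c) //= eqxx big1 ?addr0 // => i /negbTE ->.
  by rewrite mulr0n.
have -> : homotopy (koszul a b m) =
    homotopy_mon a (m + U_(b))%MM - homotopy_mon b (m + U_(a))%MM.
  rewrite /homotopy -(pick a (fun i => homotopy_mon i (m + U_(b))%MM)).
  rewrite -(pick b (fun i => homotopy_mon i (m + U_(a))%MM)) -sumrB.
  by apply: eq_bigr => i _; rewrite ffunE raddfB !raddfMn /= !mlinX.
rewrite !homotopy_monDU -scalerBr opprD addrACA -sumrB.
(* By Jacobi the difference of double brackets is [[[x_a, x_b], x_j]], and bracketing with [x_j]
   restores the factor removed from [m]. *)
have -> : \sum_j ((m j)%:R *: ad_mon (m - U_(j))%MM (lie_br (lie_br (x a) (x j)) (x b))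
    - (m j)%:R *: ad_mon (m - U_(j))%MM (lie_br (lie_br (x b) (x j)) (x a)))
  = (mdeg m)%:R *: ad_mon m (lie_br (x a) (x b)).
  rewrite mdegE natr_sum scaler_suml; apply: eq_bigr => j _.
  rewrite -scalerBr -linearB /=; case E: (m j) => [|k]; first by rewrite !scale0r.
  congr (_ *: _); rewrite lie_br_exch [lie_br (x b) (x j)]lie_brC.
  rewrite [lie_br (x a) (lie_br (x j) _)]lie_brC [lie_br (- _) _]adE linearN opprK.
  rewrite /ad subrK; have dab := der1_br (x a) (x b).
  rewrite adE ad_mon_ad // -ad_monDU // submK //.
  by apply/mnm_lepP => l; rewrite mnm1E; case: eqVneq => // <-; rewrite E.
rewrite [lie_br (x b) (x a)]lie_brC linearN opprK /= -mulr2n -scaler_nat -scalerDl.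
rewrite scalerA -natrD add2n mulVf ?scale1r //.
by rewrite ((pcharf0P K).1 charK).
Qed.

(** Removing [X_j] loses one degree, while [[x_i, x_j]] has weight two. In degree zero every summand
    vanishes. *)
Lemma gamma_homotopy_mon i m : gamma (mdeg m).+1 (homotopy_mon i m).
Proof.
apply/gammaZ/gamma_sum => j _.
case E: (m j) => [|k]; first by rewrite scale0r; apply: gamma0.
apply: gammaZ; have -> : mdeg m = (mdeg (m - U_(j)) + 1)%N.
  rewrite -(mdeg1 j) -mdegD submK //.
  by apply/mnm_lepP => l; rewrite mnm1E; case: eqVneq => // <-; rewrite E.
by apply: gamma_ad_mon; apply: gamma_br.
Qed.

Lemma gamma_homotopy k (f : {ffun 'I_n -> S}) :
  (forall i, mord k (f i)) -> gamma k.+1 (homotopy f).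
Proof.
move=> fk; apply: gamma_sum => i _; rewrite /mlin big_seq.
apply: gamma_sum => m; rewrite mcoeff_msupp => fm.
apply: gammaZ; apply: gamma_le (gamma_homotopy_mon i m).
by rewrite ltnS leqNgt; apply: contra fm => /fk->.
Qed.

End Koszul.

Lemma sum_pair (U V : nmodType) (I : Type) (r : seq I) (P : pred I)
    (f : I -> U) (g : I -> V) :
  \sum_(i <- r | P i) (f i, g i) = (\sum_(i <- r | P i) f i, \sum_(i <- r | P i) g i).
Proof. by elim/big_rec3: _ => // i u v z _ ->. Qed.

(** * Normal forms: a linear part plus a Koszul boundary *)

Section NormalForm.
Variables (K : fieldType) (n : nat) (F L : lieAlgebra K).
Variables (y : 'I_n -> F) (x : 'I_n -> L) (pi : F -> L) (theta : F -> magnus_lie K n).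
Hypothesis charK : [pchar K] =i pred0.
Hypothesis y_gen : forall w, lie_gen y w.
Hypothesis piH : lie_hom pi.
Hypothesis piy : forall i, pi (y i) = x i.
Hypothesis L_metabelian : forall u v : L, der1 u -> der1 v -> lie_br u v = 0.
Hypothesis thetaH : lie_hom theta.
Hypothesis thetay : forall i, theta (y i) = magnus_gen K i.
Local Notation S := {mpoly K[n]}.
Implicit Types (f g : {ffun 'I_n -> S}) (v : L) (a b : 'I_n -> K).

Definition linx a : L := \sum_i a i *: x i.

Lemma linxP k a b : linx (fun i => k * a i + b i) = k *: linx a + linx b.
Proof.
rewrite /linx scaler_sumr -big_split /=.
by apply: eq_bigr => i _; rewrite scalerDl scalerA.
Qed.

(* Relates a Koszul boundary to the elements of [L'] it represents, without yet knowing
   that there is only one. *)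
Definition koszul_graph f v :=
  span (fun z : {ffun 'I_n -> S} * L => exists (a b : 'I_n) m,
    z = (koszul K a b m, ad_mon x m (lie_br (x a) (x b)))) (f, v).

Lemma koszul_graphP k f g u v :
  koszul_graph f u -> koszul_graph g v -> koszul_graph (k *: f + g) (k *: u + v).
Proof. exact: spanD. Qed.

Lemma koszul_graph0 : koszul_graph 0 0.
Proof. exact: span0. Qed.

(** So [f] determines [v]; this plays the part of injectivity of the Magnus embedding on [L']. *)
Lemma homotopy_graph f v : koszul_graph f v -> homotopy x f = v.
Proof.
rewrite -[f]/((f, v).1) -[v in RHS]/((f, v).2) /koszul_graph.
elim=> [|_ [a [b [m ->]]]|k z z' _ IH _ IH'].
- by rewrite linear0.
- exact: homotopy_koszul.
- by rewrite [LHS]homotopy_is_linear IH IH'.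
Qed.

Lemma der1_graph f v : koszul_graph f v -> der1 v.
Proof.
rewrite -[v in der1 v]/((f, v).2) /koszul_graph.
elim=> [|_ [a [b [m ->]]]|k z z' _ IH _ IH'].
- exact: span0.
- exact/der1_ad_mon/der1_br.
- exact: spanD.
Qed.

Lemma mord_graph i f v : koszul_graph f v -> mord 1 (f i).
Proof.
rewrite -[f]/((f, v).1) /koszul_graph.
elim=> [|_ [a [b [m ->]]]|k z z' _ IH _ IH'].
- by rewrite ffunE; apply: mord0.
- by rewrite ffunE; apply: mordB; apply/mordMn/mordX; rewrite mdegD mdeg1 addn1.
- by rewrite !ffunE; apply/mordD/IH'/mordZ.
Qed.

Lemma koszul_graph_ad c f v : koszul_graph f v ->
  koszul_graph [ffun i => 'X_c * f i] (lie_br v (x c)).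
Proof.
pose h (z : {ffun 'I_n -> S} * L) : {ffun 'I_n -> S} * L :=
  ([ffun i => 'X_c * z.1 i], ad (x c) z.2).
apply: (span_map (f := h)) => [k z z'|_ [a [b [m ->]]]].
  congr (_, _); last by rewrite linearP.
  by apply/ffunP => i; rewrite !ffunE mulrDr -scalerAr.
apply: spanS; exists a, b, (m + U_(c))%MM.
congr (_, _); last by rewrite ad_monDU //; apply: der1_br.
apply/ffunP => i; rewrite !ffunE mulrBr !mulrnAr -!mpolyXD.
by rewrite !addmA [(U_(c) + m)%MM]addmC.
Qed.

Lemma koszul_graph_linx b f v : koszul_graph f v ->
  koszul_graph [ffun i => linform b * f i] (lie_br v (linx b)).
Proof.
move=> fv; rewrite /koszul_graph.
have -> : ([ffun i => linform b * f i], lie_br v (linx b)) =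
    \sum_c b c *: ([ffun i => 'X_c * f i], lie_br v (x c)).
  rewrite sum_pair; congr (_, _); last first.
    by rewrite linear_sum; apply: eq_bigr => c _; rewrite linearZ.
  apply/ffunP => i; rewrite sum_ffunE !ffunE mulr_suml.
  by apply: eq_bigr => c _; rewrite !ffunE scalerAl.
by apply: span_sum => c _; apply/spanZ/koszul_graph_ad.
Qed.

Lemma koszul_graph_linx2 a b :
  koszul_graph [ffun i => linform b * (a i)%:MP - linform a * (b i)%:MP]
    (lie_br (linx a) (linx b)).
Proof.
rewrite /koszul_graph; set z := (_, _).
have -> : z = \sum_j \sum_k (a j * b k) *:
    (koszul K j k 0%MM, ad_mon x 0%MM (lie_br (x j) (x k))).
  under eq_bigr do rewrite sum_pair; rewrite sum_pair; congr (_, _); last first.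
    rewrite /linx [LHS]adE linear_sum; apply: eq_bigr => j _.
    rewrite linearZ /= /ad linear_sum scaler_sumr; apply: eq_bigr => k _.
    by rewrite linearZ scalerA ad_mon0.
  apply/ffunP => i; rewrite /= sum_ffunE ffunE.
  have pick c (h : 'I_n -> S) : \sum_i h i *+ (c == i) = h c.
    rewrite (bigD1 c) //= eqxx big1 ?addr0 // => k /negbTE kc.
    by rewrite eq_sym kc mulr0n.
  transitivity (\sum_j \sum_k
      (((a j * b k) *: 'X_k) *+ (i == j) - ((a j * b k) *: 'X_j) *+ (i == k) : S)).
    under eq_bigr do rewrite sumrB pick.
    rewrite sumrB exchange_big /=; congr (_ - _).
      under eq_bigr do rewrite pick.
      rewrite mulrC mul_mpolyC scaler_sumr.
      by apply: eq_bigr => k _; rewrite scalerA.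
    rewrite mulrC mul_mpolyC scaler_sumr.
    by apply: eq_bigr => k _; rewrite scalerA mulrC.
  apply: eq_bigr => j _; rewrite sum_ffunE; apply: eq_bigr => k _.
  by rewrite [RHS]ffunE ffunE scalerBr -!scalerMnr !add0m.
apply: span_sum => j _; apply: span_sum => k _; apply/spanZ/spanS.
by exists j, k, 0%MM.
Qed.

(** The Fox components minus their constant terms [a i] represent the part of [pi w] in [L']. *)
Definition normal_form (w : F) a :=
  magnus_lin (theta w) = linform a /\
  koszul_graph [ffun i => magnus_fox i (theta w) - (a i)%:MP] (pi w - linx a).

Lemma normal_formP w : exists a, normal_form w a.
Proof.
elim: (y_gen w) => [|c|k u v _ [a [u1 u2]] _ [b [v1 v2]]|u v _ [a [u1 u2]] _ [b [v1 v2]]].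
- exists (fun=> 0); split.
    by rewrite (hom0 thetaH) linear0 /linform big1 // => i _; rewrite scale0r.
  rewrite (hom0 thetaH) (hom0 piH) /linx big1 => [|i _]; last by rewrite scale0r.
  rewrite subr0 [X in koszul_graph X](_ : _ = 0); first exact: koszul_graph0.
  by apply/ffunP => i; rewrite !ffunE linear0 subr0.
- exists (fun i => (i == c)%:R); split.
    rewrite thetay magnus_lin_gen /linform (bigD1 c) //= eqxx scale1r.
    by rewrite big1 ?addr0 // => i /negbTE ->; rewrite scale0r.
  rewrite thetay piy /linx (bigD1 c) //= eqxx scale1r.
  rewrite big1 ?addr0 => [|i /negbTE->]; last by rewrite scale0r.
  rewrite subrr [X in koszul_graph X](_ : _ = 0); first exact: koszul_graph0.
  by apply/ffunP => i; rewrite !ffunE magnus_fox_gen mpolyC_nat subrr.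
- exists (fun i => k * a i + b i); split.
    by rewrite linformP (homD thetaH) (homZ thetaH) linearP /= u1 v1.
  rewrite linxP (homD piH) (homZ piH) (homD thetaH) (homZ thetaH) opprD addrACA -scalerBr.
  rewrite [X in koszul_graph X](_ : _ =
    k *: [ffun i => magnus_fox i (theta u) - (a i)%:MP]
      + [ffun i => magnus_fox i (theta v) - (b i)%:MP]); first exact: koszul_graphP.
  apply/ffunP => i; rewrite !ffunE magnus_fox_is_linear mpolyCD mpolyCM mul_mpolyC.
  by rewrite opprD addrACA scalerBr.
- exists (fun=> 0); split.
    rewrite (hom_br thetaH) magnus_lin_br /linform big1 // => i _.
    by rewrite scale0r.
  rewrite /linx big1 => [|i _]; last by rewrite scale0r.
  rewrite subr0 (hom_br piH) (hom_br thetaH).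
  set f := [ffun i => _] in u2; set g := [ffun i => _] in v2.
  set p := pi u - _ in u2; set q := pi v - _ in v2.
  (* The bracket of [p] and [q] vanishes, both being in [L']; each of the other three terms is
     covered by a lemma on the graph. *)
  have -> : lie_br (pi u) (pi v) =
      lie_br p (linx b) + ((-1) *: lie_br q (linx a) + lie_br (linx a) (linx b)).
    have -> : pi u = p + linx a by rewrite subrK.
    have -> : pi v = q + linx b by rewrite subrK.
    move: (p) (q) (der1_graph u2) (der1_graph v2) => p' q' dp dq.
    rewrite (linearD (lie_br (p' + _))) /= !lie_br_addl L_metabelian //.
    by rewrite add0r addrCA scaleN1r -lie_brC.
  rewrite -[lie_br p _]scale1r.
  rewrite [X in koszul_graph X](_ : _ = 1 *: [ffun i => linform b * f i] +
    ((-1) *: [ffun i => linform a * g i] +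
      [ffun i => linform b * (a i)%:MP - linform a * (b i)%:MP])).
    apply: koszul_graphP; first exact: koszul_graph_linx.
    by apply: koszul_graphP; [apply: koszul_graph_linx | apply: koszul_graph_linx2].
  apply/ffunP => i; rewrite !ffunE magnus_fox_br u1 v1 scaleN1r scale1r mpolyC0.
  ring.
Qed.

(** As [theta] need not factor through [pi], an equality in [L] is transported only modulo order
    [c.+2]. By [expq_inj] the linear parts then agree and the Fox components differ in order [c.+1];
    the homotopy turns this into [gamma c.+2]. *)
Lemma eps_sum_inj c (u w : F) :
    (forall z, pi z = 0 -> forall i, mord c.+2 (magnus_fox i (theta z))) ->
    (magnus_lin (theta u)).@[fun=> 1] = (magnus_lin (theta w)).@[fun=> 1] ->
    eps c.+2 (pi u) (\sum_i x i) = eps c.+2 (pi w) (\sum_i x i) ->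
  gamma c.+2 (pi u - pi w).
Proof.
move=> pi0 eq1 eq_eps.
have [a [u1 u2]] := normal_formP u; have [b [w1 w2]] := normal_formP w.
have sum1 e : (linform e).@[fun=> 1 : K] = \sum_i e i.
  rewrite /linform raddf_sum; apply: eq_bigr => i _.
  by rewrite /= mevalZ mevalXU mulr1.
have [| |i||eq_ab fg] :=
  @expq_inj _ _ c a b (fun i => magnus_fox i (theta u))
    (fun i => magnus_fox i (theta w)) charK.
- by rewrite -!sum1 -u1 -w1.
- by move=> i; have := mord_graph i u2; rewrite ffunE.
- by have := mord_graph i w2; rewrite ffunE.
- move=> i; pose s := \sum_j y j.
  have ths1 : magnus_lin (theta s) = linform (fun=> 1).
    rewrite /s (hom_sum thetaH) linear_sum; apply: eq_bigr => j _.
    by rewrite scale1r thetay.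
  have ths2 : magnus_fox i (theta s) = 1.
    rewrite /s (hom_sum thetaH) (linear_sum (@magnus_fox K n i)) (bigD1 i) //=.
    rewrite thetay magnus_fox_gen eqxx big1 ?addr0 // => j /negbTE ij.
    by rewrite thetay magnus_fox_gen eq_sym ij.
  have pis : pi s = \sum_j x j by rewrite (hom_sum piH); apply: eq_bigr => j _.
  have := pi0 (eps c.+2 u s - eps c.+2 w s).
  rewrite (homB piH) !(hom_eps piH) pis eq_eps subrr => /(_ erefl i).
  have -> : magnus_fox i (theta (eps c.+2 u s - eps c.+2 w s)) =
      (1 + expq c.+1 (linform a) * (linform a - linform (fun=> 1) * magnus_fox i (theta u)))
      - (1 + expq c.+1 (linform b) * (linform b - linform (fun=> 1) * magnus_fox i (theta w))).
    rewrite (homB thetaH) (linearB (@magnus_fox K n i)) /=.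
    congr (_ - _); rewrite (hom_eps thetaH) magnus_eps ths1 ths2 mulr1.
      by rewrite u1.
    by rewrite w1.
  by rewrite opprD addrACA subrr add0r.
have lin_ab : linx a = linx b by apply: eq_bigr => i _; rewrite eq_ab.
have -> : pi u - pi w = (pi u - linx a) - (pi w - linx b).
  by rewrite lin_ab opprB addrA subrK.
rewrite -(homotopy_graph u2) -(homotopy_graph w2) -raddfB.
apply: gamma_homotopy => i; rewrite !ffunE eq_ab opprB addrA subrK.
exact: fg.
Qed.

End NormalForm.

Lemma lie_hom_comp (K : fieldType) (L M N : lieAlgebra K) (f : M -> N) (g : L -> M) :
  lie_hom f -> lie_hom g -> lie_hom (f \o g).
Proof.
move=> fH gH; split=> [a u v|u v] /=; first by rewrite (homD gH) (homZ gH) (homD fH) (homZ fH).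
by rewrite (hom_br gH) (hom_br fH).
Qed.

(** * The algebra [L_{n,c}] and the action of permutations *)

Section Quotient.
Variables (K : fieldType) (n c : nat) (F L : lieAlgebra K).
Variables (y : 'I_n -> F) (x : 'I_n -> L) (pi : F -> L).
Hypothesis hL : is_Lnc c y x pi.

Lemma Lnc_hom : lie_hom pi. Proof. by case: hL. Qed.
Lemma Lnc_surj v : exists w, pi w = v. Proof. by case: hL. Qed.
Lemma Lnc_gen i : pi (y i) = x i. Proof. by case: hL. Qed.
Lemma free_gen w : lie_gen y w. Proof. by case: hL => -[]. Qed.

Lemma Lnc_ker w : pi w = 0 <-> exists a b, der2 a /\ gamma c.+1 b /\ w = a + b.
Proof. by case: hL. Qed.

Lemma Lnc_lie_gen v : lie_gen x v.
Proof.
have [w <-] := Lnc_surj v; elim: (free_gen w) => [|i|a u u' _ IH _ IH'|u u' _ IH _ IH'].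
- by rewrite (hom0 Lnc_hom); apply: lie_gen0.
- by rewrite Lnc_gen; apply: lie_genG.
- by rewrite (homD Lnc_hom) (homZ Lnc_hom); apply: lie_genD.
- by rewrite (hom_br Lnc_hom); apply: lie_genB.
Qed.

Lemma Lnc_metabelian (u v : L) : der1 u -> der1 v -> lie_br u v = 0.
Proof.
move=> /(der1_lift Lnc_hom Lnc_surj)[u' [du <-]] /(der1_lift Lnc_hom Lnc_surj)[v' [dv <-]].
rewrite -(hom_br Lnc_hom); apply/Lnc_ker; exists (lie_br u' v'), 0.
split; first by apply: spanS; exists u', v'.
by split; [apply: gamma0 | rewrite addr0].
Qed.

Lemma Lnc_der2 (u : L) : der2 u -> u = 0.
Proof.
elim=> [//|_ [v [w [dv [dw ->]]]]|a v w _ -> _ ->]; first exact: Lnc_metabelian.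
by rewrite scaler0 addr0.
Qed.

Lemma Lnc_nilpotent (u : L) : gamma c.+1 u -> u = 0.
Proof.
move=> /(gamma_lift Lnc_hom Lnc_surj)[w [gw <-]]; apply/Lnc_ker.
by exists 0, w; split; [apply: span0 | rewrite add0r].
Qed.

Lemma gammaLncP k u : gammaLnc pi k u <-> gamma k u.
Proof.
split; last exact: (gamma_lift Lnc_hom Lnc_surj).
by case=> w [gw <-]; apply: gamma_hom gw; apply: Lnc_hom.
Qed.

(** A homomorphism from [F] to [L] kills the kernel of [pi], since [L] is itself metabelian and
    nilpotent. This supplies the action of each permutation. *)
Lemma Lnc_lift (m : 'I_n -> L) : exists f, lie_hom f /\ forall i, f (x i) = m i.
Proof.
have [_ free] : free_lie y by case: hL.
have [g [gH gm]] := free L m.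
have lift v : exists w, pi w == v by have [w <-] := Lnc_surj v; exists w.
pose f v := g (xchoose (lift v)).
have fpi w : f (pi w) = g w.
  apply/eqP; rewrite -subr_eq0 -(homB gH); set d := _ - w.
  have : pi d = 0 by rewrite (homB Lnc_hom) (eqP (xchooseP (lift (pi w)))) subrr.
  case/Lnc_ker => [a [b [/(der2_hom gH)/Lnc_der2 ga [/(gamma_hom gH)/Lnc_nilpotent gb ->]]]].
  by rewrite (homD gH) ga gb addr0.
exists f; split=> [|i]; last by rewrite -Lnc_gen fpi.
split=> [k u v|u v].
  have [u' <-] := Lnc_surj u; have [v' <-] := Lnc_surj v.
  by rewrite -(homZ Lnc_hom) -(homD Lnc_hom) !fpi (homD gH) (homZ gH).
have [u' <-] := Lnc_surj u; have [v' <-] := Lnc_surj v.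
by rewrite -(hom_br Lnc_hom) !fpi (hom_br gH).
Qed.

(** [gamma c] is central because [gamma c.+1] is zero, and [eps] depends on [u] only through
    brackets with it. *)
Lemma eps_center (u v : L) :
  (0 < c)%N -> gamma c (u - v) -> eps c u =1 eps c v.
Proof.
move=> c0 guv w; apply: eps_eq_ad => z; apply/eqP.
rewrite -subr_eq0 -(linearB (lie_br z)) /= lie_brC oppr_eq0; apply/eqP/Lnc_nilpotent.
by case: (c) c0 guv => // c' _; apply: gamma_br.
Qed.

(** As [f] fixes the sum of the generators, [eps_u] and [eps_(f u)] agree there. The lift [g] of [f]
    to [F] brings in [eps_sum_inj]. *)
Lemma sym_eps_gamma (charK : [pchar K] =i pred0) (u : L) (s : 'S_n) (f : L -> L) :
    (1 < c)%N -> lie_hom f -> (forall i, f (x i) = x (s i)) ->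
    f (eps c u (\sum_i x i)) = eps c u (\sum_i x i) ->
  gamma c (f u - u).
Proof.
move=> c1 fH fx f_eps; have [_ free] : free_lie y by case: hL.
have [theta [thH thy]] := free _ (@magnus_gen K n).
have [g [gH gy]] := free F (fun i => y (s i)).
have [w piw] := Lnc_surj u.
have fpi z : f (pi z) = pi (g z).
  apply: (@lie_hom_ext _ _ _ _ y free_gen (f \o pi) (pi \o g)).
  - exact: lie_hom_comp fH Lnc_hom.
  - exact: lie_hom_comp Lnc_hom gH.
  - by move=> i /=; rewrite Lnc_gen fx gy Lnc_gen.
have ker_mord z : pi z = 0 -> forall i, mord c (magnus_fox i (theta z)).
  case/Lnc_ker => [a [b [/(der2_hom thH)/magnus_der2 a0 [gb ->]]]] i.
  rewrite (homD thH) a0 add0r.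
  by have [_] := magnus_gamma_mord free_gen thH thy gb; apply.
(* Evaluation at [(1, ..., 1)] adds up the linear coefficients, and permuting generators preserves
   their sum. *)
have sum_eq : (magnus_lin (theta (g w))).@[fun=> 1] = (magnus_lin (theta w)).@[fun=> 1].
  elim: (free_gen w) => [|i|a v v' _ IH _ IH'|v v' _ _ _ _].
  - by rewrite (hom0 gH).
  - by rewrite gy !thy !magnus_lin_gen !mevalXU.
  - rewrite (homD gH) (homZ gH) !(homD thH) !(homZ thH) !magnus_lin_is_linear.
    by rewrite !mevalD !mevalZ IH IH'.
  - by rewrite (hom_br gH) !(hom_br thH) !magnus_lin_br.
rewrite -piw fpi.
case: c c1 f_eps ker_mord => [|[|d]] // _ f_eps ker_mord.
apply: (eps_sum_inj charK free_gen Lnc_hom Lnc_gen Lnc_metabelian thH thy ker_mord sum_eq).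
rewrite -fpi piw -[RHS]f_eps (hom_eps fH); congr (eps _ _ _).
rewrite (hom_sum fH) (reindex_inj (@perm_inj _ s)) /=.
by apply: eq_bigr => i _; rewrite fx.
Qed.

(** The mean of the images of [u] over [S_n] differs from [u] by the mean of the elements
    [f u - u]. *)
Lemma sym_average (charK : [pchar K] =i pred0) (u : L) :
    (forall (s : 'S_n) (f : L -> L),
      lie_hom f -> (forall i, f (x i) = x (s i)) -> gamma c (f u - u)) ->
  exists v, sym_elt x v /\ gamma c (v - u).
Proof.
move=> fu.
have /fin_all_exists[f fP] (s : 'S_n) : exists f : L -> L,
    lie_hom f /\ forall i, f (x i) = x (s i) by apply: Lnc_lift.
have N0 : #|'S_n|%:R != 0 :> K.
  by rewrite ((pcharf0P K).1 charK) -lt0n; apply/card_gt0P; exists 1%g.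
exists (#|'S_n|%:R^-1 *: \sum_s f s u); split.
  (* Composing with [g] translates the index [s] to [s * t], by uniqueness on generators. *)
  move=> t g gH gx; rewrite (homZ gH) (hom_sum gH); congr (_ *: _).
  rewrite [RHS](reindex_inj (mulIg t)) /=; apply: eq_bigr => s _.
  have [fsH fsx] := fP s; have [fstH fstx] := fP (s * t)%g.
  apply: (lie_hom_ext Lnc_lie_gen (lie_hom_comp gH fsH) fstH) => i /=.
  by rewrite fsx gx fstx permM.
rewrite [X in _ - X](_ : u = #|'S_n|%:R^-1 *: \sum_(s : 'S_n) u); last first.
  by rewrite sumr_const -scaler_nat scalerA mulVf ?scale1r // cardT.
rewrite -scalerBr -sumrB; apply/gammaZ/gamma_sum => s _.
by have [fsH fsx] := fP s; apply: (fu s).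
Qed.

End Quotient.

Theorem theorem2p3 (K : fieldType) (hK : [pchar K] =i pred0)
    (n c : nat) (hn : (2 <= n)%N) (hc : (1 <= c)%N)
    (F : lieAlgebra K) (y : 'I_n -> F)
    (L : lieAlgebra K) (x : 'I_n -> L) (pi : F -> L)
    (hL : is_Lnc c y x pi) :
  forall f : L -> L,
    ((exists u : L, f =1 eps c u) /\
     (forall v : L, sym_elt x v -> sym_elt x (f v)))
    <->
    ((exists u : L, [/\ sym_elt x u,
                        ~ (gammaLnc pi c u /\ sym_elt x u)
                      & f =1 eps c u])
     \/ f =1 id).
Proof.
move=> f; split; last first.
  case=> [[u [symu _ fu]]|fid].
    split; first by exists u.
    move=> v symv s g gH gx; rewrite fu (hom_eps gH).
    by rewrite (symu s g gH gx) (symv s g gH gx).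
  split; first by exists 0 => v; rewrite fid eps0.
  by move=> v symv; rewrite fid.
case=> [[u fu] fsym].
(* For [c = 1] only the term [k = 0] of [eps] is present, so [f] is the identity. *)
have [c1|c1] := leqP c 1.
  have c_eq : c = 1%N by apply/eqP; rewrite eqn_leq c1 hc.
  by right=> v; rewrite fu c_eq eps1.
have sum_sym : sym_elt x (\sum_i x i).
  move=> s g gH gx; rewrite (hom_sum gH) [RHS](reindex_inj (@perm_inj _ s)) /=.
  by apply: eq_bigr => i _; rewrite gx.
have [|v [symv guv]] := sym_average hL hK (u := u).
  move=> s g gH gx; apply: (sym_eps_gamma hL hK c1 gH gx).
  by have := fsym _ sum_sym s g gH gx; rewrite fu.
have fv : f =1 eps c v by move=> z; rewrite fu (eps_center hL hc guv).
(* If [v] lies in [gamma c] then [eps_v = eps_0 = 1]; otherwise [v] is the required witness. *)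
have [gv|ngv] := classic (gammaLnc pi c v); last first.
  by left; exists v; split=> // -[].
right=> z; rewrite fv (eps_center hL (v := 0) hc) ?eps0 //.
by rewrite subr0; apply/(gammaLncP hL).
Qed.
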